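(* Let $M$ be a smooth manifold of dimension $n\ge 2$ and let $\bar g(t)$, $t\in I$ ($I$ an interval), be a Ricci flow on modified Riemann extensions over $M$; that is, a smooth family of metrics on $T^*M$ satisfying $\frac{\partial \bar g}{\partial t}=-2\,\overline{\mathrm{Ric}}(\bar g(t))$ and such that all the metrics $\bar g(t)$ can be expressed as modified Riemann extensions of a base metric: there is a metric $g$ on $M$, with Levi-Civita connection $\nabla$, such that for each $t\in I$ the metric $\bar g(t)$ is the modified Riemann extension determined by $\nabla$ and some symmetric $(0,2)$ tensor field $c(t)$ on $M$. Let $\bar R_{abcd}$ and $\bar W_{abcd}$ ($a,b,c,d\in\{1,\dots,2n\}$) be the components of the $(0,4)$ Riemann curvature tensor and of the Weyl conformal tensor of $\bar g(t)$ in coordinates $(x^1,\dots,x^n,\omega_1,\dots,\omega_n)$ on $T^*M$ induced by coordinates of $M$. Then the rate of change of the extended components of the Weyl conformal tensor is the same as the rate of change of the extended components of the Riemann curvature tensor: whenever any two of the indices $a,b,c,d$ are greater than $n$, and in particular when all of them are greater than $n$, $$\frac{\partial \bar W_{abcd}}{\partial t}=\frac{\partial \bar R_{abcd}}{\partial t}.$$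
   Context: Let $M$ be an $n$-dimensional smooth manifold, $\nabla$ a torsion-free affine connection on $M$ with coefficients $\Gamma^l_{ij}$ in local coordinates $(x^1,\dots,x^n)$, and $c=(c_{ij})$ a symmetric $(0,2)$ tensor field on $M$. Let $(x^1,\dots,x^n,\omega_1,\dots,\omega_n)$ be the induced coordinates on the cotangent bundle $T^*M$ (the $\omega_i$ are the fibre, or ''extended'', coordinates); unstarred indices $i,j$ range over $1,\dots,n$ and refer to $x^i$, while starred indices $i^*=n+i$ range over $n+1,\dots,2n$ and refer to $\omega_i$. The modified Riemann extension determined by $(\nabla,c)$ is the pseudo-Riemannian metric $\bar g$ on $T^*M$ with local components $$\bar g_{ij}=-2\,\omega_l\Gamma^l_{ij}+c_{ij},\qquad \bar g_{ij^*}=\bar g_{j^*i}=\delta_i^j,\qquad \bar g_{i^*j^*}=0.$$ When $\nabla$ is the Levi-Civita connection of a metric $g$ on $M$, $\bar g$ is called a modified Riemann extension of the base metric $g$. $\overline{\mathrm{Ric}}(\bar g)$, with components $\bar R_{ab}$, denotes the Ricci tensor of the Levi-Civita connection of $\bar g$ on the $2n$-dimensional manifold $T^*M$. Curvature conventions on $T^*M$, where $\bar\Gamma^d_{bc}$ are the Christoffel symbols of $\bar g$: $\bar R^{d}{}_{abc}=\partial_a\bar\Gamma^d_{bc}-\partial_b\bar\Gamma^d_{ac}+\bar\Gamma^d_{am}\bar\Gamma^m_{bc}-\bar\Gamma^d_{bm}\bar\Gamma^m_{ac}$, $\bar R_{abcd}=\bar g_{mc}\bar R^m{}_{abd}$,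 and $\bar R_{bd}=\bar g^{ac}\bar R_{abcd}$. The scalar curvature of a modified Riemann extension vanishes, so its Weyl conformal tensor is $$\bar W_{abcd}=\bar R_{abcd}-\frac{1}{2n-2}\left(\bar g_{ac}\bar R_{bd}-\bar g_{ad}\bar R_{bc}-\bar g_{bc}\bar R_{ad}+\bar g_{bd}\bar R_{ac}\right).$$ *)

(* Defs.v *)
From HB Require Import structures.
From mathcomp Require Import all_boot all_order all_algebra.
From mathcomp Require Import all_classical all_reals all_analysis.

Set Implicit Arguments.
Unset Strict Implicit.
Unset Printing Implicit Defensive.

Import Order.TTheory GRing.Theory Num.Theory.
Import numFieldNormedType.Exports.

Local Open Scope classical_set_scope.
Local Open Scope ring_scope.

Section Calculus.
Context {R : realType}.

Definition partial m (i : 'I_m) (f : 'rV[R]_m -> R) (x : 'rV[R]_m) : R :=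
  'D_(delta_mx 0 i) f x.

(* C^infinity on an open set V: all iterated partial derivatives exist and are
   continuous. *)
Definition smooth_on m (V : set 'rV[R]_m) (f : 'rV[R]_m -> R) : Prop :=
  forall s : seq 'I_m,
    let h := foldr (@partial m) f s in
    {within V, continuous h} /\
    forall x i, V x -> derivable h x (delta_mx 0 i).

Definition smooth_map_on m p (V : set 'rV[R]_m) (f : 'rV[R]_m -> 'rV[R]_p) :
    Prop :=
  forall k, smooth_on V (fun x => f x 0 k).

Definition time_interval (J : set R) : Prop :=
  is_interval J /\ exists s t, [/\ J s, J t & s < t].

(* Derivative with respect to time relative to the interval J, hence one-sided
   at an end point that belongs to J. *)
Definition time_quotient (f : R -> R) (t s : R) : R := (f s - f t) / (s - t).

Definition is_time_derive (J : set R) (f : R -> R) (t l : R) : Prop :=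
  time_quotient f t s @[s --> within J t^'] --> l.

Definition time_derivable (J : set R) (f : R -> R) (t : R) : Prop :=
  exists l, is_time_derive J f t l.

Definition time_derive (J : set R) (f : R -> R) (t : R) : R :=
  lim (time_quotient f t s @[s --> within J t^']).

(* In a word of mixed derivatives, None stands for the time derivative and
   Some i for the i-th space derivative. *)
Definition mixed_partial (J : set R) m (o : option 'I_m)
    (f : R -> 'rV[R]_m -> R) : R -> 'rV[R]_m -> R :=
  fun t x => if o is Some i then partial i (f t) x
             else time_derive J (fun s => f s x) t.

Definition smooth_family (J : set R) m (V : set 'rV[R]_m)
    (f : R -> 'rV[R]_m -> R) : Prop :=
  forall s : seq (option 'I_m),
    let h := foldr (@mixed_partial J m) f s in
    [/\ {within J `*` V, continuous (fun p : R * 'rV[R]_m => h p.1 p.2)},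
        forall t x i, J t -> V x -> derivable (h t) x (delta_mx 0 i) &
        forall t x, J t -> V x -> time_derivable J (fun s => h s x) t].

End Calculus.

Section Manifolds.
Context {R : realType}.

(* chart_inv is only meaningful on the image of chart_dom. *)
Record chart (n : nat) (M : Type) := Chart {
  chart_dom : set M;
  chart_map : M -> 'rV[R]_n;
  chart_inv : 'rV[R]_n -> M }.

Section Charts.
Context {n : nat} {M : topologicalType}.
Implicit Types phi psi : chart n M.

Definition chart_image phi : set 'rV[R]_n := chart_map phi @` chart_dom phi.

Definition is_chart phi : Prop :=
  [/\ open (chart_dom phi), open (chart_image phi),
      {in chart_dom phi, cancel (chart_map phi) (chart_inv phi)},
      {within chart_dom phi, continuous (chart_map phi)} &
      {within chart_image phi, continuous (chart_inv phi)}].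

Definition overlap phi psi : set 'rV[R]_n :=
  chart_map phi @` (chart_dom phi `&` chart_dom psi).

Definition transition phi psi : 'rV[R]_n -> 'rV[R]_n :=
  chart_map psi \o chart_inv phi.

Definition compatible phi psi : Prop :=
  smooth_map_on (overlap phi psi) (transition phi psi) /\
  smooth_map_on (overlap psi phi) (transition psi phi).

End Charts.

Record smoothManifold (n : nat) := SmoothManifold {
  carrier : topologicalType;
  atlas : set (chart n carrier);
  manifold_hausdorff : hausdorff_space carrier;
  manifold_second_countable : @second_countable carrier;
  atlas_chart : forall phi, atlas phi -> is_chart phi;
  atlas_cover : forall p, exists2 phi, atlas phi & chart_dom phi p;
  atlas_compatible : forall phi psi, atlas phi -> atlas psi ->
    compatible phi psi;
  atlas_maximal : forall phi, is_chart phi ->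
    (forall psi, atlas psi -> compatible phi psi) -> atlas phi }.

#[global] Arguments atlas {n} M : rename.

(* A system of local coordinates on an m-dimensional manifold: the coordinate
   images of the charts, the coordinate images of the overlaps, and the
   coordinate changes. Tensor fields are families of components, one for each
   chart, obeying the tensor transformation law. *)
Record coordSystem (m : nat) := CoordSystem {
  cs_chart : Type;
  cs_image : cs_chart -> set 'rV[R]_m;
  cs_overlap : cs_chart -> cs_chart -> set 'rV[R]_m;
  cs_change : cs_chart -> cs_chart -> 'rV[R]_m -> 'rV[R]_m }.

Definition coordinates n (M : smoothManifold n) : coordSystem n :=
  @CoordSystem n {phi | atlas M phi}
    (fun phi => chart_image (sval phi))
    (fun phi psi => overlap (sval phi) (sval psi))
    (fun phi psi => transition (sval phi) (sval psi)).

(* The induced coordinates (x, omega) on the cotangent bundle: x is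
   [lsubmx z], omega is [rsubmx z], and
   omega'_k = \sum_i omega_i (dx^i / dx'^k). *)
Definition cotangent_coordinates n (M : smoothManifold n) :
    coordSystem (n + n) :=
  @CoordSystem (n + n) {phi | atlas M phi}
    (fun phi => [set z | chart_image (sval phi) (lsubmx z)])
    (fun phi psi => [set z | overlap (sval phi) (sval psi) (lsubmx z)])
    (fun phi psi z =>
       let x' := transition (sval phi) (sval psi) (lsubmx z) in
       row_mx x'
         (\row_k \sum_i rsubmx z 0 i *
            partial k (fun y => transition (sval psi) (sval phi) y 0 i) x')).

Definition components m (C : coordSystem m) : Type :=
  cs_chart C -> 'rV[R]_m -> 'M[R]_m.

Definition transforms_as_02 m (C : coordSystem m) (T : components C) : Prop :=
  forall (al be : cs_chart C) x, cs_overlap al be x ->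
    let tau := cs_change al be in
    T al x = \matrix_(i, j) \sum_k \sum_l
      partial i (fun y => tau y 0 k) x * partial j (fun y => tau y 0 l) x *
      T be (tau x) k l.

Definition tensor02 m (C : coordSystem m) (T : components C) : Prop :=
  (forall al i j, smooth_on (cs_image al) (fun x => T al x i j)) /\
  transforms_as_02 T.

Definition symmetric02 m (C : coordSystem m) (T : components C) : Prop :=
  forall al x, cs_image al x -> (T al x)^T = T al x.

(* Metrics may be indefinite. *)
Definition metric m (C : coordSystem m) (g : components C) : Prop :=
  [/\ tensor02 g, symmetric02 g &
      forall al x, cs_image al x -> g al x \in unitmx].

Definition smooth_metric_family (J : set R) m (C : coordSystem m)
    (g : R -> components C) : Prop :=
  (forall t, J t -> metric (g t)) /\
  forall al i j, smooth_family J (cs_image al) (fun t x => g t al x i j).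

End Manifolds.

(* The metric G is given by its components in one coordinate chart. *)
Section Curvature.
Context {R : realType} {m : nat}.
Variable G : 'rV[R]_m -> 'M[R]_m.
Implicit Types (x : 'rV[R]_m) (a b c d : 'I_m).

(* christoffel x d b c is Gamma^d_{bc}. *)
Definition christoffel x d b c : R :=
  2^-1 * \sum_e invmx (G x) d e *
    (partial b (fun y => G y e c) x + partial c (fun y => G y e b) x
     - partial e (fun y => G y b c) x).

(* riemann_up x d a b c is R^d_{abc}. *)
Definition riemann_up x d a b c : R :=
  partial a (fun y => christoffel y d b c) x
  - partial b (fun y => christoffel y d a c) x
  + (\sum_k christoffel x d a k * christoffel x k b c)
  - (\sum_k christoffel x d b k * christoffel x k a c).

Definition riemann x a b c d : R := \sum_k G x k c * riemann_up x k a b d.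

Definition ricci x b d : R :=
  \sum_a \sum_c invmx (G x) a c * riemann x a b c d.

(* The scalar curvature term is absent: this is the Weyl tensor of a metric
   with vanishing scalar curvature, such as a modified Riemann extension. *)
Definition weyl x a b c d : R :=
  riemann x a b c d - (m%:R - 2)^-1 *
    (G x a c * ricci x b d - G x a d * ricci x b c
     - G x b c * ricci x a d + G x b d * ricci x a c).

End Curvature.

Section RiemannExtensions.
Context {R : realType} {n : nat}.

(* Gamma x l i j is the connection coefficient Gamma^l_{ij}. *)
Definition modified_riemann_extension
    (Gamma : 'rV[R]_n -> 'I_n -> 'I_n -> 'I_n -> R) (c : 'rV[R]_n -> 'M[R]_n)
    (z : 'rV[R]_(n + n)) : 'M[R]_(n + n) :=
  block_mx
    (\matrix_(i, j) (- 2 * (\sum_l rsubmx z 0 l * Gamma (lsubmx z) l i j)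
                     + c (lsubmx z) i j)) 1%:M
    1%:M 0.

Variable M : @smoothManifold R n.

Definition is_modified_riemann_extension (g : components (coordinates M))
    (c : components (coordinates M))
    (G : components (cotangent_coordinates M)) : Prop :=
  forall (phi : {phi | atlas M phi}) z,
    cs_image (phi : cs_chart (cotangent_coordinates M)) z ->
    G phi z = modified_riemann_extension (christoffel (g phi)) (c phi) z.

Definition modified_riemann_extensions_of_base (J : set R)
    (G : R -> components (cotangent_coordinates M)) : Prop :=
  exists2 g : components (coordinates M), metric g &
    forall t, J t -> exists c : components (coordinates M),
      [/\ tensor02 c, symmetric02 c & is_modified_riemann_extension g c (G t)].

End RiemannExtensions.

Definition ricci_flow {R : realType} m (C : @coordSystem R m) (J : set R)
    (G : R -> components C) : Prop :=
  smooth_metric_family J G /\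
  forall t al x a b, J t -> cs_image al x ->
    is_time_derive J (fun s => G s al x a b) t (- 2 * ricci (G t al) x a b).

(* Indices are 0-based: the extended indices n + i are those that are >= n. *)
Definition extended_index n (a : 'I_(n + n)) : bool := (n <= a)%N.

(* Main.v *)
Require Import Defs.
From HB Require Import structures.
From mathcomp Require Import all_boot all_order all_algebra.
From mathcomp Require Import all_classical all_reals all_analysis.
Import Order.TTheory GRing.Theory Num.Theory.
Import numFieldNormedType.Exports.
Local Open Scope classical_set_scope.
Local Open Scope ring_scope.

(** The total space of the cotangent bundle carries a grading: say that a
    function of (x, omega) has fibre degree at most k when it is polynomial of
    degree at most k in omega, so that degree 0 means depending on x alone
    and negative degree means zero.  A component of a modified Riemann
    extension has degree at most 1 minus the number of its extended indices:
    the block of base indices is affine in omega, the mixed blocks are constant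
    and the block of extended indices vanishes.  Every operation that leads
    from the metric to the curvature respects this count.  The inverse metric
    has degree at most the number of its extended indices minus 1; a derivative
    along x keeps the degree and a derivative along omega, which is one more
    extended lower index, lowers it by 1; products add degrees.  Hence
    Gamma^d_{bc} has degree at most w(d) - w(b) - w(c), where w is 1 on
    extended indices and 0 on the others, R^d_{abc} has degree at most
    w(d) - w(a) - w(b) - w(c), and both R_{abcd} and W_{abcd} have degree at
    most 1 - w(a) - w(b) - w(c) - w(d).

    As soon as two of the indices are extended this bound is negative, so
    R_{abcd} and W_{abcd} vanish identically, for every metric of the family
    ([riemann_eq0], [weyl_eq0]).  Their rates of change are therefore both
    zero.

    The sign of the degree is all that matters, so the lemmas below only
    speak of vanishing (negative degree) and of depending on x alone
    (degree at most 0); the only exact derivative needed is the derivative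
    along the fibre of the affine block of the metric ([dmetric_fibre]). *)

(** * Derivatives over a cylinder *)

Section FibreDegree.
Context {R : realType} {n : nat}.
Context {U : set 'rV[R]_n} (openU : open U).
Context {Gamma : 'rV[R]_n -> 'I_n -> 'I_n -> 'I_n -> R}
        {c : 'rV[R]_n -> 'M[R]_n}.
Context {G : 'rV[R]_(n + n) -> 'M[R]_(n + n)}.
Context (GE : forall z, U (lsubmx z) ->
  G z = modified_riemann_extension Gamma c z).
Implicit Types (z : 'rV[R]_(n + n)) (f : 'rV[R]_(n + n) -> R)
  (a b d e : 'I_(n + n)).

Local Notation V := [set z : 'rV[R]_(n + n) | U (lsubmx z)].
Local Notation w := (@extended_index n).

Lemma near_line_in_cylinder z v : V z ->
  \forall h \near (0 : R)^', V (h *: v + z).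
Proof.
move=> Vz; apply: nbhs_dnbhs.
have cont : (fun h : R => h *: lsubmx v + lsubmx z) @ 0 --> lsubmx z.
  rewrite -{2}[lsubmx z]add0r -(scale0r (lsubmx v)).
  by apply: cvgD; [apply: cvgZr_tmp; exact: cvg_id|exact: cvg_cst].
have : \forall h \near (0 : R), U (h *: lsubmx v + lsubmx z).
  by apply: cont; apply: open_nbhs_nbhs; split.
by apply: filterS => h; rewrite /= linearP.
Qed.

(** The equation is only asked for inside the cylinder over [U], which is
    where the metric is known; nearby points of the line stay inside it, and
    there the difference quotient is constantly [l]. *)
Lemma partial_affine f a z l : V z ->
  (forall h, V (h *: delta_mx 0 a + z) ->
    f (h *: delta_mx 0 a + z) = f z + h * l) ->
  partial a f z = l.
Proof.
move=> Vz fE; rewrite /partial /derive.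
apply: lim_near_cst => //.
near=> h; rewrite /= fE; last by near: h; exact: near_line_in_cylinder.
rewrite addrC addrA addNr add0r -[LHS]/(h^-1 * (h * l)) mulKf //.
by near: h; exact: nbhs_dnbhs_neq.
Unshelve. all: by end_near. Qed.

Lemma partial_cst_on f a z k : V z -> (forall y, V y -> f y = k) ->
  partial a f z = 0.
Proof.
by move=> Vz fk; apply: partial_affine => // h Vh; rewrite !fk ?mulr0 ?addr0.
Qed.

(** Fibre degree at most 0: on the cylinder over [U], [f] is the pull-back of
    a function on the base. *)
Definition basic f := forall y z, V y -> V z -> lsubmx y = lsubmx z -> f y = f z.

Lemma lsubmx_fibre_line a z h : w a -> lsubmx (h *: delta_mx 0 a + z) = lsubmx z.
Proof.
case: (split_ordP a) => i -> wa.
  by rewrite /extended_index /= leqNgt ltn_ord in wa.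
by apply/rowP => j; rewrite !mxE eqxx /= eq_lrshift mulr0 add0r.
Qed.

Lemma partial_basic f a z : V z -> w a -> basic f -> partial a f z = 0.
Proof.
move=> Vz wa fb; apply: partial_affine => // h Vh.
by rewrite mulr0 addr0; apply: fb => //; exact: lsubmx_fibre_line.
Qed.

(** * Degrees of the metric, its inverse and its derivatives *)

Lemma extended_lshift i : w (lshift n i) = false.
Proof. by rewrite /extended_index /= leqNgt ltn_ord. Qed.

Lemma extended_rshift i : w (rshift n i).
Proof. exact: leq_addr. Qed.

Lemma metric_eq0 z b d : V z -> (2 <= w b + w d)%N -> G z b d = 0.
Proof.
move=> Vz; rewrite GE // /modified_riemann_extension.
case: (split_ordP b) => i ->; case: (split_ordP d) => j ->;
  rewrite ?extended_lshift ?extended_rshift // => _.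
by rewrite block_mxEdr mxE.
Qed.

Lemma metric_cst y z b d : V y -> V z -> (1 <= w b + w d)%N -> G y b d = G z b d.
Proof.
move=> Vy Vz; rewrite !GE // /modified_riemann_extension.
case: (split_ordP b) => i ->; case: (split_ordP d) => j ->;
  rewrite ?extended_lshift ?extended_rshift // => _.
- by rewrite !block_mxEur.
- by rewrite !block_mxEdl.
- by rewrite !block_mxEdr.
Qed.

(** Inversion swaps the roles of the two diagonal blocks, so that for the
    inverse metric it is the block of base indices that vanishes: this is what
    makes raising an index compatible with the count of extended indices. *)
Lemma invmx_metric z : V z ->
  invmx (G z) = block_mx 0 1%:M 1%:M (- ulsubmx (G z)).
Proof.
move=> Vz; set B := RHS.
have GB : G z *m B = 1%:M.
  rewrite /B GE // /modified_riemann_extension block_mxKul mulmx_block.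
  rewrite !mulmx0 !mul0mx !mulmx1 !mul1mx !add0r !addr0 subrr.
  by rewrite -scalar_mx_block.
by rewrite -[RHS](mulKmx (mulmx1_unit GB).1) GB mulmx1.
Qed.

Lemma invmx_metric_eq0 z b d : V z -> (w b + w d = 0)%N -> invmx (G z) b d = 0.
Proof.
move=> Vz; rewrite invmx_metric //.
case: (split_ordP b) => i ->; case: (split_ordP d) => j ->;
  rewrite ?extended_lshift ?extended_rshift // => _.
by rewrite block_mxEul mxE.
Qed.

Lemma invmx_metric_cst y z b d : V y -> V z -> (w b + w d <= 1)%N ->
  invmx (G y) b d = invmx (G z) b d.
Proof.
move=> Vy Vz; rewrite !invmx_metric //.
case: (split_ordP b) => i ->; case: (split_ordP d) => j ->;
  rewrite ?extended_lshift ?extended_rshift // => _.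
- by rewrite !block_mxEul.
- by rewrite !block_mxEur.
- by rewrite !block_mxEdl.
Qed.

(** A component with an extended index is constant. *)
Lemma dmetric_mixed_eq0 z a b d : V z -> (1 <= w b + w d)%N ->
  partial a (fun y => G y b d) z = 0.
Proof.
by move=> Vz bd; apply: (@partial_cst_on _ _ _ (G z b d)) => // y Vy;
  exact: metric_cst.
Qed.

(** The coefficient of omega_l in the affine block; the result depends on x
    alone. *)
Lemma dmetric_fibre z l i j : V z ->
  partial (rshift n l) (fun y => G y (lshift n i) (lshift n j)) z
  = - 2 * Gamma (lsubmx z) l i j.
Proof.
move=> Vz; apply: partial_affine => // h Vh.
rewrite !GE // /modified_riemann_extension !block_mxEul !mxE.
rewrite lsubmx_fibre_line ?extended_rshift //.
rewrite [RHS]addrAC; congr (_ + _).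
rewrite mulrCA -mulrDr; congr (_ * _).
have rE k : rsubmx (h *: delta_mx 0 (rshift n l) + z) 0 k
    = h * (k == l)%:R + rsubmx z 0 k.
  by rewrite !mxE eqxx /= eq_rshift.
under eq_bigr do rewrite rE mulrDl.
rewrite big_split /= addrC; congr (_ + _).
rewrite (bigD1 l) //= eqxx mulr1 big1 ?addr0 // => k /negbTE ->.
by rewrite mulr0 mul0r.
Qed.

Lemma dmetric_eq0 z a b d : V z -> (2 <= w a + w b + w d)%N ->
  partial a (fun y => G y b d) z = 0.
Proof.
by move=> Vz abd; apply: dmetric_mixed_eq0 => //;
  move: abd; case: (w a); case: (w b); case: (w d).
Qed.

Lemma dmetric_basic a b d : (1 <= w a + w b + w d)%N ->
  basic (partial a (fun y => G y b d)).
Proof.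
move=> abd y z Vy Vz yz.
have [bd|] := boolP (1 <= w b + w d)%N; first by rewrite !dmetric_mixed_eq0.
move: abd.
case: (split_ordP a) => l ->; case: (split_ordP b) => i ->;
  case: (split_ordP d) => j ->; rewrite ?extended_lshift ?extended_rshift // => _ _.
by rewrite !dmetric_fibre // yz.
Qed.

(** * Degrees of the connection and of the curvature *)

(** In each term g^{de} (...) of the sum over e, either d and e are both base
    indices and g^{de} is zero, or w(e) + w(a) + w(b) is at least 2, and so the
    derivatives of the metric are zero. *)
Lemma christoffel_eq0 z d a b : V z -> (w d < w a + w b)%N ->
  christoffel G z d a b = 0.
Proof.
move=> Vz dab; rewrite /christoffel big1 ?mulr0 // => e _.
have [de|de] := posnP (w d + w e)%N; first by rewrite invmx_metric_eq0 ?mul0r.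
rewrite !dmetric_eq0 ?addr0 ?subr0 ?mulr0 //;
by move: dab de; case: (w a); case: (w b); case: (w d); case: (w e).
Qed.

(** A term that is not zero has w(d) + w(e) = 1, so that g^{de} is constant,
    and then w(e) + w(a) + w(b) = 1, so that the derivatives of the metric
    depend on x alone. *)
Lemma christoffel_basic d a b : (w d <= w a + w b)%N ->
  basic (fun z => christoffel G z d a b).
Proof.
move=> dab y z Vy Vz yz; rewrite /christoffel; congr (_ * _).
apply: eq_bigr => e _.
have [de|de] := posnP (w d + w e)%N; first by rewrite !invmx_metric_eq0 ?mul0r.
have [eab|eab] := leqP 2 (w e + w a + w b)%N.
  rewrite !dmetric_eq0 ?addr0 ?subr0 ?mulr0 //;
  by move: eab; case: (w a); case: (w b); case: (w e).
congr (_ * _); first apply: invmx_metric_cst => //.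
  by move: dab de eab; case: (w a); case: (w b); case: (w d); case: (w e).
congr (_ + _ - _); apply: dmetric_basic => //;
by move: dab de eab; case: (w a); case: (w b); case: (w d); case: (w e).
Qed.

(** If [a] is a base index then Gamma^d_{bc} is already zero near the point;
    if [a] is extended then Gamma^d_{bc} depends on x alone. *)
Lemma dchristoffel_eq0 z a d b e : V z -> (w d < w a + w b + w e)%N ->
  partial a (fun y => christoffel G y d b e) z = 0.
Proof.
move=> Vz dabe; have [wa|wa] := boolP (w a).
  by apply: partial_basic => //; apply: christoffel_basic; move: dabe; rewrite wa.
apply: (@partial_cst_on _ _ _ 0) => // y Vy; apply: christoffel_eq0 => //.
by move: dabe; rewrite (negbTE wa).
Qed.

(** The degrees add up: the summation index [k], once upper and once lower,
    cancels, so one of the two factors has negative degree. *)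
Lemma christoffel_mul_eq0 z d a b e k : V z -> (w d < w a + w b + w e)%N ->
  christoffel G z d a k * christoffel G z k b e = 0.
Proof.
move=> Vz dabe; have [kbe|kbe] := ltnP (w k) (w b + w e)%N.
  by rewrite [X in _ * X]christoffel_eq0 ?mulr0.
rewrite christoffel_eq0 ?mul0r //.
by apply: leq_trans dabe _; rewrite -addnA leq_add2l.
Qed.

Lemma riemann_up_eq0 z d a b e : V z -> (w d < w a + w b + w e)%N ->
  riemann_up G z d a b e = 0.
Proof.
move=> Vz dabe; have dbae : (w d < w b + w a + w e)%N by rewrite (addnC (w b)).
rewrite /riemann_up !dchristoffel_eq0 // !big1 ?addr0 ?subr0 // => k _;
exact: christoffel_mul_eq0.
Qed.

Lemma riemann_eq0 z a b d e : V z -> (2 <= w a + w b + w d + w e)%N ->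
  riemann G z a b d e = 0.
Proof.
move=> Vz abde; rewrite /riemann big1 // => k _.
have [kd|kd] := leqP 2 (w k + w d)%N; first by rewrite metric_eq0 ?mul0r.
rewrite riemann_up_eq0 ?mulr0 //.
by move: abde kd; case: (w a); case: (w b); case: (w d); case: (w e); case: (w k).
Qed.

(** A contraction with g^{ad}, where a or d must be extended, adds at least one
    extended index to those of the Ricci tensor, and R_{abde} then has two. *)
Lemma ricci_eq0 z b e : V z -> (1 <= w b + w e)%N -> ricci G z b e = 0.
Proof.
move=> Vz be; rewrite /ricci big1 // => a _; rewrite big1 // => d _.
have [ad|ad] := posnP (w a + w d)%N; first by rewrite invmx_metric_eq0 ?mul0r.
rewrite riemann_eq0 ?mulr0 //.
by move: be ad; case: (w a); case: (w b); case: (w d); case: (w e).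
Qed.

Lemma metric_mul_ricci_eq0 z a b d e : V z -> (2 <= w a + w b + w d + w e)%N ->
  G z a b * ricci G z d e = 0.
Proof.
move=> Vz abde; have [de|de] := posnP (w d + w e)%N; last by rewrite ricci_eq0 ?mulr0.
by rewrite metric_eq0 ?mul0r //; move: abde; rewrite -addnA de addn0.
Qed.

Lemma weyl_eq0 z a b d e : V z -> (2 <= w a + w b + w d + w e)%N ->
  weyl G z a b d e = 0.
Proof.
move=> Vz abde; rewrite /weyl riemann_eq0 // !metric_mul_ricci_eq0 //;
  first by rewrite !subr0 addr0 mulr0 subr0.
all: by move: abde; case: (w a); case: (w b); case: (w d); case: (w e).
Qed.

End FibreDegree.

(** * Time derivatives *)

(** The functions of time may differ off [J], where a family of metrics is
    arbitrary; [time_derive] only sees their values on [J]. *)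
Lemma time_quotient_eq_in (R : realType) (J : set R) (f g : R -> R) t :
  J t -> {in J, f =1 g} ->
  \forall s \near within J t^', time_quotient f t s = time_quotient g t s.
Proof.
move=> Jt fg; rewrite near_withinE; near=> s => Js.
by rewrite /time_quotient !fg ?inE.
Unshelve. all: by end_near. Qed.

Lemma time_derive_eq_in (R : realType) (J : set R) (f g : R -> R) t :
  J t -> {in J, f =1 g} -> time_derive J f t = time_derive J g t.
Proof.
move=> Jt fg; have gf : {in J, g =1 f} by move=> s Js; rewrite fg.
rewrite /time_derive; congr (lim _); apply/seteqP; split => A /=.
- by apply: filterS2 (time_quotient_eq_in _ _ _ _ _ Jt gf) => s;
    rewrite /preimage /= => <-.
- by apply: filterS2 (time_quotient_eq_in _ _ _ _ _ Jt fg) => s;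
    rewrite /preimage /= => <-.
Qed.

Lemma time_derivable_eq0_in (R : realType) (J : set R) (f : R -> R) t :
  J t -> (forall s, J s -> f s = 0) -> time_derivable J f t.
Proof.
move=> Jt f0; exists 0; apply: cvg_near_cst.
rewrite near_withinE; near=> s => Js.
by rewrite /time_quotient !f0 // subrr mul0r.
Unshelve. all: by end_near. Qed.

Theorem theorem5 (R : realType) (n : nat) (hn : (2 <= n)%N)
    (M : @smoothManifold R n) (J : set R) (hJ : time_interval J)
    (G : R -> components (cotangent_coordinates M))
    (hflow : ricci_flow J G)
    (hext : modified_riemann_extensions_of_base J G)
    (phi : cs_chart (cotangent_coordinates M)) (z : 'rV[R]_(n + n))
    (hz : cs_image phi z) (t : R) (ht : J t) (a b c d : 'I_(n + n))
    (habcd : (2 <= extended_index a + extended_index b + extended_index c + extended_index d)%N) :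
  [/\ time_derivable J (fun s => weyl (G s phi) z a b c d) t,
      time_derivable J (fun s => riemann (G s phi) z a b c d) t &
      time_derive J (fun s => weyl (G s phi) z a b c d) t
      = time_derive J (fun s => riemann (G s phi) z a b c d) t].
Proof.
have [g _ Gext] := hext.
have openU : open (chart_image (sval phi)).
  by have [_ oU _ _ _] := atlas_chart (svalP phi).
have GE s : J s -> exists c, forall y, chart_image (sval phi) (lsubmx y) ->
    G s phi y = modified_riemann_extension (christoffel (g phi)) c y.
  by move=> /Gext [c' [_ _ cE]]; exists (c' phi) => y Uy; exact: cE.
have R0 s : J s -> riemann (G s phi) z a b c d = 0.
  by move=> /GE [c' cE]; exact: (riemann_eq0 openU cE).
have W0 s : J s -> weyl (G s phi) z a b c d = 0.
  by move=> /GE [c' cE]; exact: (weyl_eq0 openU cE).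
split; [exact: time_derivable_eq0_in|exact: time_derivable_eq0_in|].
by apply: time_derive_eq_in => // s; rewrite inE => Js; rewrite R0 ?W0.
Qed.
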